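(* Let $T$ be a tree, let $f:T\to T$ be a continuous map, and let $(\mathrm{Con}(T),\mathcal{F})$ be the connected envelope of $(T,f)$. Then $h(\mathcal{F})=h(f)$, where $h$ denotes topological entropy.
   Context: An interval is any space homeomorphic to $[0,1]\subset\mathbb{R}$. A tree is a uniquely arcwise connected space that is either a single point or a union of finitely many intervals; here it is regarded as a metric space with some fixed compatible metric. A continuum is a nonempty compact connected metric space. $\mathrm{Con}(T)$ denotes the set of all subcontinua of $T$ (including singletons), endowed with the Hausdorff metric; it is a compact metric space. The connected envelope of $(T,f)$ is the dynamical system $(\mathrm{Con}(T),\mathcal{F})$, where $\mathcal{F}:\mathrm{Con}(T)\to\mathrm{Con}(T)$ is the continuous map $\mathcal{F}(A)=f(A)=\{f(x):x\in A\}$. Topological entropy (Bowen--Dinaburg): for a compact metric space $(X,\rho)$ and a continuous map $g:X\to X$, put $\rho^{(n)}(x,y)=\max_{0\le j<n}\rho(g^j(x),g^j(y))$. A set $E\subseteq X$ is $(n,g,\varepsilon)$-separated if $\rho^{(n)}(x,y)>\varepsilon$ for all distinct $x,y\in E$; let $\mathrm{sep}(n,g,\varepsilon)$ be the maximal cardinality of such a set. Then $h(g)=\lim_{\varepsilon\to0}\limsup_{n\to\infty}\frac1n\log \mathrm{sep}(n,g,\varepsilon)\in[0,+\infty]$. *)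

(* Defs.v *)
From HB Require Import structures.
From mathcomp Require Import all_boot all_order all_algebra.
From mathcomp Require Import all_classical all_reals all_analysis.

Set Implicit Arguments.
Unset Strict Implicit.
Unset Printing Implicit Defensive.

Import Order.TTheory GRing.Theory Num.Theory.
Import numFieldNormedType.Exports.

Local Open Scope classical_set_scope.
Local Open Scope ring_scope.

Section homeomorphisms.
Context (X Y : topologicalType).

Definition homeomorphism (f : X -> Y) : Prop :=
  continuous f /\ exists g : Y -> X, [/\ continuous g, cancel f g & cancel g f].

Definition homeomorphic : Prop := exists f : X -> Y, homeomorphism f.

End homeomorphisms.

Section intervals_and_trees.
Context (R : realType).

(* A set coerced to a type carries the subspace topology. *)
Definition unit_interval : topologicalType := [set` `[0%R, 1%R] : interval R].

Lemma unit_interval0_in : (0 : R) \in [set` `[0, 1] : interval R].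
Proof. by rewrite inE /= in_itv /= lexx ler01. Qed.

Lemma unit_interval1_in : (1 : R) \in [set` `[0, 1] : interval R].
Proof. by rewrite inE /= in_itv /= ler01 lexx. Qed.

Definition unit_interval0 : unit_interval := SigSub unit_interval0_in.
Definition unit_interval1 : unit_interval := SigSub unit_interval1_in.

Definition topological_interval (X : topologicalType) : Prop :=
  homeomorphic unit_interval X.

Definition arc_between (X : topologicalType) (x y : X) (A : set X) : Prop :=
  exists f : unit_interval -> A,
    [/\ homeomorphism f, set_val (f unit_interval0) = x
      & set_val (f unit_interval1) = y].

Definition uniquely_arcwise_connected (X : topologicalType) : Prop :=
  forall x y : X, x <> y -> exists! A : set X, arc_between x y A.

(* The union has at least one member: a tree is nonempty. *)
Definition tree (X : topologicalType) : Prop :=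
  uniquely_arcwise_connected X /\
  ((exists x : X, [set: X] = [set x]) \/
   (exists (n : nat) (A : 'I_n.+1 -> set X),
      (forall i, topological_interval (A i)) /\
      [set: X] = \bigcup_i A i)).

End intervals_and_trees.

Section hausdorff_distance.
Context (R : realType) (T : metricType R).
Implicit Types (x y : T) (A B C : set T).

Definition dist_to_set x A : R := inf [set mdist x a | a in A].

Definition hausdorff_dist A B : R :=
  Num.max (sup [set dist_to_set a B | a in A])
          (sup [set dist_to_set b A | b in B]).

Lemma compact_mdist_bounded A x :
  compact A -> exists M : R, forall a, A a -> mdist x a <= M.
Proof.
rewrite compact_near_coveringP => cA.
have [a Aa|n _ nA] := cA nat \oo (fun n a => mdist x a < n%:R).
  exists (ball a 1, [set n | (Num.truncn (mdist x a + 1)).+1 <= n]%N).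
    by split => /=; [exact: nbhsx_ballx|exact: nbhs_infty_ge].
  move=> [b n] /= []; rewrite ballEmdist /= => ab xan.
  apply: (le_lt_trans (metric_triangle _ a _)).
  apply: (@lt_le_trans _ _ (mdist x a + 1)); first by rewrite ltrD2l.
  by rewrite ltW // (lt_le_trans (truncnS_gt _)) // ler_nat.
by exists n%:R => a Aa; apply/ltW; exact: (nA n (leqnn n)).
Qed.

Lemma dist_to_set_has_lbound x A : has_lbound [set mdist x a | a in A].
Proof. by exists 0 => _ [a _ <-]; exact: mdist_ge0. Qed.

Lemma dist_to_set_le x A a : A a -> dist_to_set x A <= mdist x a.
Proof. by move=> Aa; apply: ge_inf; [exact: dist_to_set_has_lbound|exists a]. Qed.

Lemma dist_to_set_ge x A r : A !=set0 ->
  (forall a, A a -> r <= mdist x a) -> r <= dist_to_set x A.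
Proof.
move=> [a Aa] rA; apply: lb_le_inf; first by exists (mdist x a), a.
by move=> _ [b Ab <-]; exact: rA.
Qed.

Lemma dist_to_set_ge0 x A : A !=set0 -> 0 <= dist_to_set x A.
Proof. by move=> A0; apply: dist_to_set_ge => // a _; exact: mdist_ge0. Qed.

Lemma dist_to_set_lt x A r : A !=set0 -> dist_to_set x A < r ->
  exists2 a, A a & mdist x a < r.
Proof.
move=> A0; rewrite ltNge => /negP xr; apply: contrapT => h; apply: xr.
apply: dist_to_set_ge => // a Aa; rewrite leNgt; apply/negP => ax.
by apply: h; exists a.
Qed.

Lemma dist_to_set_has_ubound A B :
  compact A -> B !=set0 -> has_ubound [set dist_to_set a B | a in A].
Proof.
move=> cA [b Bb]; have [M MA] := compact_mdist_bounded b cA.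
exists M => _ [a Aa <-]; apply: le_trans (dist_to_set_le a Bb) _.
by rewrite metric_sym; exact: MA.
Qed.

Lemma hausdorff_distC A B : hausdorff_dist A B = hausdorff_dist B A.
Proof. by rewrite /hausdorff_dist maxC. Qed.

Lemma dist_to_set_le_hausdorff A B a : compact A -> B !=set0 ->
  A a -> dist_to_set a B <= hausdorff_dist A B.
Proof.
move=> cA B0 Aa; rewrite /hausdorff_dist le_max; apply/orP; left.
by apply: ub_le_sup; [exact: dist_to_set_has_ubound|exists a].
Qed.

Lemma hausdorff_dist_le A B r : A !=set0 -> B !=set0 ->
  (forall a, A a -> dist_to_set a B <= r) ->
  (forall b, B b -> dist_to_set b A <= r) -> hausdorff_dist A B <= r.
Proof.
move=> [a Aa] [b Bb] Ar Br; rewrite /hausdorff_dist ge_max; apply/andP; split.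
- by apply: ge_sup; [exists (dist_to_set a B), a|move=> _ [c Ac <-]; exact: Ar].
- by apply: ge_sup; [exists (dist_to_set b A), b|move=> _ [c Bc <-]; exact: Br].
Qed.

Lemma hausdorff_distxx A : compact A -> A !=set0 -> hausdorff_dist A A = 0.
Proof.
move=> cA A0; apply/eqP; rewrite eq_le; apply/andP; split.
  have A_le0 a : A a -> dist_to_set a A <= 0.
    by move=> Aa; rewrite -(mdistxx a); exact: dist_to_set_le.
  exact: hausdorff_dist_le.
case: (A0) => a Aa; apply: le_trans (dist_to_set_ge0 a A0) _.
exact: dist_to_set_le_hausdorff.
Qed.

Lemma hausdorff_dist0_subset A B : compact A -> compact B -> B !=set0 ->
  hausdorff_dist A B = 0 -> A `<=` B.
Proof.
move=> cA cB B0 AB0 a Aa.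
have clB : closed B by apply: compact_closed cB; exact: metric_hausdorff.
rewrite closure_id in clB; rewrite clB => U; rewrite -nbhs_ballE => -[e /= e0 eU].
have : dist_to_set a B < e.
  by apply: le_lt_trans e0; rewrite -AB0; exact: dist_to_set_le_hausdorff.
move=> /(dist_to_set_lt B0)[b Bb ab]; exists b; split => //.
by apply: eU; rewrite ballEmdist.
Qed.

Lemma dist_to_set_triangle A B C a : compact A -> compact B ->
  B !=set0 -> C !=set0 -> A a ->
  dist_to_set a C <= hausdorff_dist A B + hausdorff_dist B C.
Proof.
move=> cA cB B0 C0 Aa.
apply: (@le_trans _ _ (dist_to_set a B + hausdorff_dist B C)); last first.
  by rewrite lerD2r; exact: dist_to_set_le_hausdorff.
rewrite -lerBlDr; apply: dist_to_set_ge => // b Bb; rewrite lerBlDr.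
apply: (@le_trans _ _ (mdist a b + dist_to_set b C)); last first.
  by rewrite lerD2l; exact: dist_to_set_le_hausdorff.
rewrite -lerBlDl; apply: dist_to_set_ge => // c Cc; rewrite lerBlDl.
exact: le_trans (dist_to_set_le a Cc) (metric_triangle _ _ _).
Qed.

End hausdorff_distance.

Section subcontinua.
Context (R : realType) (T : metricType R).

Definition subcontinuum (A : set T) : Prop :=
  [/\ A !=set0, compact A & connected A].

Definition Con : Type := {A : set T | A \in [set B | subcontinuum B]}.

HB.instance Definition _ := Choice.on Con.

Lemma ConP (A : Con) : subcontinuum (val A).
Proof. exact: set_mem (valP A). Qed.

Definition Con_dist (A B : Con) : R := hausdorff_dist (val A) (val B).

Lemma Con_distxx A : Con_dist A A = 0.
Proof. by have [A0 cA _] := ConP A; exact: hausdorff_distxx. Qed.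

Lemma Con_dist_positivity A B : Con_dist A B = 0 -> A = B.
Proof.
have [A0 cA _] := ConP A; have [B0 cB _] := ConP B => AB0.
apply: val_inj; apply/seteqP; split; apply: hausdorff_dist0_subset => //.
by rewrite hausdorff_distC.
Qed.

Lemma Con_dist_sym A B : Con_dist A B = Con_dist B A.
Proof. exact: hausdorff_distC. Qed.

Lemma Con_dist_triangle B A C : Con_dist A C <= Con_dist A B + Con_dist B C.
Proof.
have [A0 cA _] := ConP A; have [B0 cB _] := ConP B; have [C0 cC _] := ConP C.
apply: hausdorff_dist_le => // [a Aa|c Cc]; first exact: dist_to_set_triangle.
rewrite addrC [X in X + _]hausdorff_distC [X in _ + X]hausdorff_distC.
exact: dist_to_set_triangle.
Qed.

HB.instance Definition _ := isMetric.Build R Con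
  Con_distxx Con_dist_positivity Con_dist_sym Con_dist_triangle.

Lemma subcontinuum_image (f : T -> T) (A : set T) :
  continuous f -> subcontinuum A -> subcontinuum (f @` A).
Proof.
move=> cf [[a Aa] cA coA]; split; first by exists (f a), a.
- by apply: continuous_compact => //; exact: continuous_subspaceT.
- by apply: connected_continuous_connected => //; exact: continuous_subspaceT.
Qed.

Definition envelope_map (f : T -> T) (cf : continuous f) (A : Con) : Con :=
  SigSub (mem_set (subcontinuum_image cf (ConP A))).

End subcontinua.

Section entropy.
Context (R : realType) (X : metricType R) (g : X -> X).

Definition bowen_dist (n : nat) (x y : X) : R :=
  \big[Num.max/0]_(j < n) mdist (iter j g x) (iter j g y).

Definition separated_set (n : nat) (eps : R) (E : set X) : Prop :=
  forall x y, E x -> E y -> x <> y -> eps < bowen_dist n x y.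

(* [counting E] is the cardinality of [E], with value [+oo] if [E] is infinite. *)
Definition sep (n : nat) (eps : R) : \bar R :=
  ereal_sup [set counting E | E in separated_set n eps].

(* The term of index 0 does not affect the upper limit. *)
Definition entropy_at (eps : R) : \bar R :=
  limn_esup (fun n => ((n%:R)^-1%:E * lne (sep n eps))%E).

Definition topological_entropy : \bar R :=
  lim (entropy_at eps @[eps --> 0^'+]).

Lemma entropy_at_nonincreasing :
  {homo entropy_at : e1 e2 / (e1 <= e2)%R >-> (e2 <= e1)%E}.
Proof.
move=> e1 e2 e12.
have sep_ge0 n e : (0 <= sep n e)%E.
  apply: le_ereal_sup_tmp; exists (counting (set0 : set X)); first by exists set0.
  by rewrite /counting; case: ifPn.
have sep_le n : (sep n e2 <= sep n e1)%E.
  apply: ge_ereal_sup => _ [E sE <-]; apply: ereal_sup_ubound.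
  exists E => // x y Ex Ey xy.
  by rewrite (le_lt_trans e12) // sE.
rewrite /entropy_at !limn_esup_lim; apply: lee_lim; [exact: is_cvg_esups..|].
apply: nearW => n; apply: ge_ereal_sup => _ [m /= nm <-].
apply: (@le_trans _ _ ((m%:R)^-1%:E * lne (sep m e1))%E); last first.
  by apply: ereal_sup_ubound; exists m.
rewrite lee_wpmul2l ?lee_fin ?invr_ge0 //.
by rewrite lee_lne ?in_itv /= ?sep_ge0 ?leey.
Qed.

Lemma is_cvg_entropy_at : cvg (entropy_at eps @[eps --> 0^'+]).
Proof.
apply: nonincreasing_at_right_is_cvge; apply: nearW => x a b _ _.
exact: entropy_at_nonincreasing.
Qed.

End entropy.

(* Main.v *)
Require Import Defs.
From mathcomp Require Import all_boot all_order all_algebra.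
From mathcomp Require Import all_classical all_reals all_analysis.
From mathcomp Require Import finmap lra zify.

(** Singletons embed the system [(T, f)] isometrically in its connected
    envelope, which gives one inequality ([sep_le_envelope]). The other one says
    that, up to a factor polynomial in [n], the envelope has no more separated
    orbit segments of length [n] than [f] itself ([sep_envelope_le]).

    Fix a finite set [P] such that every subcontinuum missing [P] has small
    diameter ([connected_mesh]), and follow a subcontinuum [A] up to the first
    time [t] at which its image meets [P]. Before [t] the images of [A] are
    small, so they are shadowed by the orbit of any point of [A]: this costs one
    element of a spanning set of [f]. At time [t] the image contains a point [p]
    of the finite set [P], and from then on polynomially many choices suffice,
    for the following two reasons.

    - The subcontinua through [p] are controlled by boundedly many nested
      families. The trace of a subcontinuum on an arc of the tree is an interval
      ([trace_interval]), and all the nonempty traces, on a given arc, of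
      subcontinua through [p] share a parameter, the gate ([gate_exists]). The
      gate cuts each trace in two halves, and the halves on a given side of the
      gates form a chain for inclusion ([half_nested]).

    - A chain has polynomial complexity. Cover [T] by finitely many small sets
      and record which of them are met by the first [n] images of a set [C].
      This record is monotone in [C], so that along a chain it is determined by
      its cardinality ([hits_nested]), a number of size linear in [n].

    The tree structure is used only through [trace_interval]. If [A] is
    connected and misses a point [z], then any two points of [A] are joined by
    an arc avoiding [z], because the complement of [z] is a finite union of
    half-open arcs ([connected_avoid_reach]). If [z] lay on an arc of the tree
    between two points of [A], there would be two different arcs joining
    them. *)

Set Implicit Arguments.
Unset Strict Implicit.
Unset Printing Implicit Defensive.

Import Order.TTheory GRing.Theory Num.Theory.
Import numFieldNormedType.Exports.

Local Open Scope classical_set_scope.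
Local Open Scope ring_scope.

(** * Arcs *)

Lemma closed_sup_mem (R : realType) (D : set R) :
  closed D -> D !=set0 -> has_ubound D -> D (sup D).
Proof.
by move=> cD D0 ubD; rewrite [D in D _](closure_id D).1 //; exact: closure_sup.
Qed.

Lemma closed_inf_mem (R : realType) (D : set R) :
  closed D -> D !=set0 -> has_lbound D -> D (inf D).
Proof.
move=> cD [u Du] /has_lb_ubN ubD.
have : (-%R @` D) (sup (-%R @` D)).
  apply: closed_sup_mem ubD; last by exists (- u), u.
  have -> : -%R @` D = -%R @^-1` D.
    apply/seteqP; split => v /=; first by case=> w Dw <-; rewrite opprK.
    by move=> Dv; exists (- v); rewrite ?opprK.
  by apply: closed_comp cD => v _; exact: opp_continuous.
by move=> [v Dv vE]; rewrite /inf -vE opprK.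
Qed.

Section arcs.
Context (R : realType) (T : metricType R).
Implicit Types (x y z : T) (S A : set T) (g : R -> T) (a b c d : R).

(** The case [a = b] is allowed: degenerate arcs let a one-point tree, and the
    concatenation of arcs one of which shrinks to a point, be treated uniformly. *)
Definition arc_param g a b : Prop :=
  [/\ a <= b, {within `[a, b], continuous g} & {in `[a, b] &, injective g}].

Definition is_arc x y S : Prop :=
  exists g a b, [/\ arc_param g a b, g a = x, g b = y & S = g @` `[a, b]].

Lemma arc_param_sub g a b c d : a <= c -> c <= d -> d <= b ->
  arc_param g a b -> arc_param g c d.
Proof.
move=> ac cd db [ab cg ig].
have sub u : u \in `[c, d] -> u \in `[a, b].
  by rewrite !in_itv /= => /andP[cu ud]; rewrite (le_trans ac) // (le_trans ud).
split => //; last by move=> u v /sub ua /sub va; exact: ig.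
by apply: continuous_subspaceW cg => u /=; exact: sub.
Qed.

Lemma within_continuous_precomp (h : R -> R) (A B : set R) g :
  continuous h -> (forall u, B u -> A (h u)) -> {within A, continuous g} ->
  {within B, continuous (g \o h)}.
Proof.
move=> ch hBA /continuous_closedP cg; apply/continuous_closedP => W cW.
have /closed_subspaceP[V cV VW] := cg _ cW.
apply/closed_subspaceP; exists (h @^-1` V).
  by apply: closed_comp cV => u _; exact: ch.
apply/seteqP; split => u [/= Vu Bu]; split => //; have Ahu := hBA _ Bu.
- by have [] : (g @^-1` W `&` A) (h u) by rewrite -VW.
- by have [] : (V `&` A) (h u) by rewrite VW.
Qed.

Lemma arc_param_rev g a b : arc_param g a b ->
  arc_param (g \o -%R) (- b) (- a).
Proof.
move=> [ab cg ig].
have neg u : u \in `[- b, - a] -> - u \in `[a, b].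
  by rewrite !in_itv /= => /andP[? ?]; apply/andP; split; lra.
split; first by rewrite lerN2.
- apply: within_continuous_precomp cg => [u|u /neg //].
  exact: opp_continuous.
- move=> u v /neg ua /neg va /= /(ig _ _ ua va); exact: oppr_inj.
Qed.

Lemma arc_param_image_compact g a b : arc_param g a b -> compact (g @` `[a, b]).
Proof. by move=> [_ cg _]; apply: continuous_compact cg _; exact: segment_compact. Qed.

Lemma arc_param_image_closed g a b : arc_param g a b -> closed (g @` `[a, b]).
Proof.
by move=> /arc_param_image_compact; apply: compact_closed; exact: metric_hausdorff.
Qed.

Lemma is_arc_sym x y S : is_arc x y S -> is_arc y x S.
Proof.
move=> [g [a [b [gab gx gy ->]]]].
exists (g \o -%R), (- b), (- a); split; rewrite /= ?opprK //.
  exact: arc_param_rev.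
apply/seteqP; split => _ [u /= uab <-].
  exists (- u); rewrite /= ?opprK //.
  by move: uab; rewrite !in_itv /= => /andP[? ?]; apply/andP; split; lra.
exists (- u) => //=.
by move: uab; rewrite !in_itv /= => /andP[? ?]; apply/andP; split; lra.
Qed.

Lemma arc_param_glue g h a s t b : a <= s -> t <= b ->
  arc_param g a s -> arc_param h t b -> g s = h t ->
  (forall u v, u \in `[a, s[ -> v \in `[t, b] -> g u <> h v) ->
  is_arc (g a) (h b) (g @` `[a, s] `|` h @` `[t, b]).
Proof.
move=> as_ tb [_ cg ig] [_ ch ih] gsht dis.
pose k u := if u <= s then g u else h (u - s + t).
have kg u : u <= s -> k u = g u by rewrite /k => ->.
have kh u : s <= u -> k u = h (u - s + t).
  rewrite le_eqVlt => /predU1P[<-|su]; last by rewrite /k leNgt su.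
  by rewrite kg // subrr add0r.
have shift u : u \in `[s, b - t + s] -> u - s + t \in `[t, b].
  by rewrite !in_itv /= => /andP[? ?]; apply/andP; split; lra.
have kinj u v : u \in `[a, b - t + s] -> v \in `[a, b - t + s] -> u <= v ->
    k u = k v -> u = v.
  rewrite !in_itv /= => /andP[au ub] /andP[av vb] uv.
  have [vs|sv] := leP v s.
    rewrite !kg // ?(le_trans uv) // => /ig; apply; rewrite in_itv /= ?au ?av //.
    exact: le_trans uv vs.
  have [su|us] := leP s u.
    rewrite !kh // ?(ltW sv) // => /ih kk.
    have := kk (shift _ _) (shift _ _); rewrite !in_itv /= su ub (ltW sv) vb.
    by move=> /(_ isT isT); lra.
  rewrite kg ?(ltW us) // kh ?(ltW sv) // => /dis []; first by rewrite in_itv /= au us.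
  by apply: shift; rewrite in_itv /= (ltW sv) vb.
have abs : a <= b - t + s by lra.
exists k, a, (b - t + s); split.
- split => //.
    have -> : `[a, b - t + s]%classic = `[a, s]%classic `|` `[s, b - t + s]%classic.
      apply/seteqP; split => u /=; rewrite !in_itv /=.
        by case/andP => au ub; case: (leP u s) => us; [left|right];
          rewrite ?au ?us // (ltW us) ub.
      by case=> /andP[? ?]; apply/andP; split; lra.
    apply: withinU_continuous; [exact: itv_closed|exact: itv_closed| |].
      apply/(@subspace_eq_continuous _ _ _ g k); last exact: cg.
      by move=> u /set_mem; rewrite /= in_itv /= => /andP[_ us]; rewrite kg.
    apply/(@subspace_eq_continuous _ _ _ (h \o (fun u => u - s + t)) k).
      by move=> u /set_mem; rewrite /= in_itv /= => /andP[su _]; rewrite kh.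
    apply: within_continuous_precomp ch => [u|u /shift //].
    by apply: cvgD; [apply: cvgB; [exact: cvg_id|exact: cvg_cst]|exact: cvg_cst].
  move=> u v uI vI kk; have [uv|vu] := leP u v; first exact: kinj kk.
  by apply/esym; apply: kinj => //; exact: ltW.
- by rewrite kg.
- by rewrite kh; [congr h; lra|lra].
apply/seteqP; split => y.
  case=> -[u /= + <-].
    rewrite in_itv /= => /andP[au us]; exists u; last by rewrite kg.
    by rewrite /= in_itv /= au; lra.
  rewrite in_itv /= => /andP[tu ub]; exists (u - t + s).
    by rewrite /= in_itv /=; apply/andP; split; lra.
  by rewrite kh; [congr h; lra|lra].
move=> [u /=]; rewrite in_itv /= => /andP[au ub] <-.
have [us|su] := leP u s.
  by left; exists u; rewrite ?kg //= in_itv /= au.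
right; exists (u - s + t); last by rewrite kh // ltW.
by apply: shift; rewrite in_itv /= ltW.
Qed.

(** Follow the first arc up to the first point [g s] that it shares with the
    second one, then the second arc from that point on. The choice of [s] makes
    the two portions meet only at [g s]. *)
Lemma is_arc_concat x y z S1 S2 : is_arc x y S1 -> is_arc y z S2 ->
  exists2 S, is_arc x z S & S `<=` S1 `|` S2.
Proof.
move=> [g [a [b [gab <- gb ->]]]] [h [c [d [hcd hc <- ->]]]].
have [ab cg ig] := gab; have [cd ch ih] := hcd.
pose D := [set u | u \in `[a, b] /\ (h @` `[c, d]) (g u)].
have Db : D b.
  split; first by rewrite in_itv /= ab lexx.
  by rewrite gb; exists c => //=; rewrite in_itv /= lexx cd.
have clD : closed D.
  have /continuous_closedP/(_ _ (arc_param_image_closed hcd)) := cg.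
  move/closed_subspaceP => [V cV VE].
  have -> : D = V `&` `[a, b]%classic.
    rewrite VE; apply/seteqP; split => u; first by move=> [? ?]; split.
    by move=> [? ?]; split.
  by apply: closedI => //; exact: itv_closed.
have lbD : has_lbound D by exists a => u [+ _]; rewrite in_itv /= => /andP[].
have infD : D (inf D) by apply: closed_inf_mem => //; exists b.
case: infD => s_in [t t_in ht].
set s := inf D in s_in ht.
have [ac sb] : a <= s /\ s <= b by move: s_in; rewrite in_itv /= => /andP[].
have [ct td] : c <= t /\ t <= d by move: t_in; rewrite /= in_itv /= => /andP[].
exists (g @` `[a, s] `|` h @` `[t, d]).
  apply: arc_param_glue => //.
  - exact: arc_param_sub gab.
  - exact: arc_param_sub hcd.
  move=> u v; rewrite !in_itv /= => /andP[au us] /andP[tv vd] guhv.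
  suff : s <= u by rewrite leNgt us.
  apply: ge_inf lbD _ _; split; first by rewrite in_itv /= au (le_trans (ltW us)).
  by exists v => //=; rewrite in_itv /= vd (le_trans ct).
apply: setUSS => _ [u /= + <-]; rewrite in_itv /= => /andP[? ?]; exists u => //=;
  rewrite in_itv /=; apply/andP; split; lra.
Qed.

(** The parametrization is a continuous bijection from a compact space onto a
    Hausdorff one, hence a homeomorphism. *)
Lemma is_arc_arc_between x y S : x <> y -> is_arc x y S -> arc_between R x y S.
Proof.
move=> xy [g [a [b [[ab cg ig] gx gy SE]]]].
have ltab : a < b.
  by rewrite lt_neqAle ab andbT; apply/eqP => abE; apply: xy; rewrite -gx -gy abE.
pose h (u : R) := g (a + u * (b - a)).
have lin u : u \in `[0, 1] -> a + u * (b - a) \in `[a, b].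
  rewrite !in_itv /= => /andP[u0 u1]; apply/andP; split; nra.
have ch : {within `[0, 1], continuous h}.
  apply: (within_continuous_precomp _ _ cg) => [u|u]; last exact: lin.
  by apply: cvgD; [exact: cvg_cst|apply: cvgM; [exact: cvg_id|exact: cvg_cst]].
have hS (u : R) : u \in `[0, 1] -> h u \in S.
  by move=> /lin uab; apply: mem_set; rewrite SE; exists (a + u * (b - a)).
have hinj (u v : R) : u \in `[0, 1] -> v \in `[0, 1] -> h u = h v -> u = v.
  move=> /lin ua /lin va /(ig _ _ ua va)/addrI/mulIf; apply.
  by rewrite subr_eq0 gt_eqF.
have hsurj y' : S y' -> exists2 u : R, u \in `[0, 1] & h u = y'.
  rewrite SE => -[u /=]; rewrite in_itv /= => /andP[au ub] <-.
  have ba0 : b - a != 0 by rewrite subr_eq0 gt_eqF.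
  exists ((u - a) / (b - a)); last by rewrite /h mulfVK // addrC subrK.
  rewrite in_itv /= divr_ge0 ?subr_ge0 //=.
  by rewrite ler_pdivrMr ?subr_gt0 // mul1r lerD2r.
have I01 (u : unit_interval R) : val u \in `[0, 1] by have /set_mem := valP u.
pose F (u : unit_interval R) : S := exist _ (h (val u)) (hS _ (I01 u)).
have G_ex (s : S) : exists u : unit_interval R, F u = s.
  have [u uI hu] := hsurj _ (set_mem (valP s)).
  exists (exist _ u (mem_set uI)); exact: val_inj.
have [G GK] := choice G_ex.
exists F; split; last 2 first.
- by rewrite -gx /= set_valE /= /h mul0r addr0.
- by rewrite -gy /= set_valE /= /h mul1r addrC subrK.
have Finj : injective F.
  by move=> u v /(congr1 val) /= /(hinj _ _ (I01 u) (I01 v)) /val_inj.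
split.
  apply: continuous_comp_initial.
  by have /subspace_sigL_continuousP := ch.
exists G; split; [|by move=> u; apply: Finj; rewrite GK|by []].
apply/continuous_closedP => C cC.
(* A closed subset of the interval is the trace of a closed set of reals. *)
have [D cD DC] : exists2 D : set R, closed D & C = set_val @^-1` D.
  have : open (~` C) by exact: closed_openC.
  case=> D oD DC; exists (~` D); first exact: open_closedC.
  by rewrite -[C]setCK -DC.
have -> : G @^-1` C = set_val @^-1` (h @` (D `&` `[0, 1]%classic)).
  apply/seteqP; split => s /=.
    rewrite DC /= => DG; exists (val (G s)); first by split => //; exact: I01.
    by rewrite -[in RHS](GK s).
  move=> [u [Du uI] hu]; rewrite DC /=.
  have -> // : G s = exist _ u (mem_set uI).
  by apply: Finj; rewrite GK; apply: val_inj; exact: (esym hu).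
apply: closed_comp => [s _|]; first exact: initial_continuous.
apply: compact_closed; first exact: metric_hausdorff.
apply: continuous_compact.
  by apply: continuous_subspaceW ch; exact: subIsetr.
by rewrite setIC; apply: compact_closedI => //; exact: segment_compact.
Qed.

Lemma topological_interval_param A : topological_interval R A ->
  exists g a b, arc_param g a b /\ A = g @` `[a, b].
Proof.
move=> [F [cF [G [cG FK GK]]]].
pose h (u : R) := set_val (F (insubd (unit_interval0 R) u)).
exists h, 0, 1; split.
  split => //.
    apply/subspace_sigL_continuousP.
    have -> : sigL `[0, 1]%classic h = set_val \o F.
      by apply/funext => u; rewrite /= /sigL /= /h set_valE valKd.
    move=> u; apply: continuous_comp; first exact: cF.
    exact: initial_continuous.
  move=> u v uI vI /val_inj /(can_inj FK) /(congr1 val).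
  by rewrite !val_insubd !mem_set.
apply/seteqP; split => y.
  move=> Ay; exists (val (G (exist _ y (mem_set Ay)))).
    by have /set_mem := valP (G (exist _ y (mem_set Ay))).
  by rewrite /h valKd GK.
by move=> [u _ <-]; rewrite /h; exact: set_mem (valP _).
Qed.

End arcs.

(** * Traces of connected sets on the arcs of a tree *)

Section convexity.
Context (R : realType) (T : metricType R).

Definition unique_arcs : Prop := forall (x y : T) (S1 S2 : set T),
  x <> y -> is_arc x y S1 -> is_arc x y S2 -> S1 = S2.

Context (N : nat) (g : 'I_N -> R -> T) (a b : 'I_N -> R).

Definition arc_cover : Prop :=
  (forall i, arc_param (g i) (a i) (b i)) /\
  (forall x, exists i, (g i @` `[a i, b i]) x).

Definition trace (i : 'I_N) (A : set T) : set R :=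
  [set u | u \in `[a i, b i] /\ A (g i u)].

Context (uT : unique_arcs).
Context (cT : arc_cover).

Let gP i : arc_param (g i) (a i) (b i). Proof. exact: cT.1. Qed.

(** The point [z] cuts the arc of index [k.1] into two half-open arcs; when it
    does not lie on that arc, both pieces are the whole arc. *)
Let piece (z : T) (k : 'I_N * bool) : set T :=
  g k.1 @` [set u | u \in `[a k.1, b k.1] /\ g k.1 u <> z /\
    forall v, v \in `[a k.1, b k.1] -> g k.1 v = z -> if k.2 then u < v else v < u].

Lemma closed_trace i A : closed A -> closed (trace i A).
Proof.
move=> cA; have [_ cg _] := gP i.
have /continuous_closedP/(_ _ cA)/closed_subspaceP[V cV VE] := cg.
have -> : trace i A = V `&` `[a i, b i]%classic.
  by rewrite VE; apply/seteqP; split => u [? ?]; split.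
by apply: closedI => //; exact: itv_closed.
Qed.

(** Adding [z] to a piece makes it closed, so pieces are relatively closed in the
    complement of [z]. *)
Lemma piece_closed z k : exists C, closed C /\
  forall x, x <> z -> piece z k x <-> C x.
Proof.
pose D := [set u | u \in `[a k.1, b k.1] /\
  forall v, v \in `[a k.1, b k.1] -> g k.1 v = z -> if k.2 then u <= v else v <= u].
have DE : D = `[a k.1, b k.1]%classic `&` \bigcap_(v in trace k.1 [set z])
    (if k.2 then `]-oo, v] else `[v, +oo[)%classic.
  apply/seteqP; split => u [uI uD]; split => //.
    by move=> v [vI /= vz]; have := uD v vI vz; case: (k.2); rewrite /= in_itv /= ?andbT.
  by move=> v vI vz; have := uD v (conj vI vz); case: (k.2); rewrite /= in_itv /= ?andbT.
exists (g k.1 @` D); split.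
  apply: compact_closed; first exact: metric_hausdorff.
  have [_ cg _] := gP k.1; apply: continuous_compact.
    by apply: continuous_subspaceW cg => u [].
  rewrite DE; apply: compact_closedI; first exact: segment_compact.
  by apply: closed_bigI => v _; case: (k.2); apply: interval_closed.
move=> x xz; split => -[u].
  move=> [uI [uz uv]] <-; exists u => //; split => // v vI vz.
  by have := uv v vI vz; case: (k.2); exact: ltW.
move=> [uI uv] ux; exists u => //; split => //; split; first by rewrite ux.
move=> v vI vz; have := uv v vI vz.
have uv' : u != v by apply/eqP => E; apply: xz; rewrite -ux E.
by case: (k.2); rewrite lt_neqAle ?(eq_sym v) ?uv'.
Qed.

Lemma piece_cover z x : x <> z -> exists k, piece z k x.
Proof.
move=> xz; have [i [u uI ux]] := cT.2 x; have [_ _ ig] := gP i.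
pose k b := (i, b) : 'I_N * bool.
have uz : g i u <> z by rewrite ux.
have [[v vI [vz uv]]|nv] :=
    pselect (exists2 v, v \in `[a i, b i] & g i v = z /\ u <= v).
  exists (k true), u => //; split => //; split => // w wI wz.
  have -> : w = v by apply: ig => //; rewrite vz.
  by rewrite lt_neqAle uv andbT; apply/eqP => E; apply: uz; rewrite E.
exists (k false), u => //; split => //; split => // v vI vz.
by rewrite /= ltNge; apply/negP => uv; apply: nv; exists v.
Qed.

Definition avoid_reach (z x y : T) : Prop := exists2 S, is_arc x y S & ~ S z.

Lemma avoid_reach_trans z x y w :
  avoid_reach z x y -> avoid_reach z y w -> avoid_reach z x w.
Proof.
move=> [S1 S1P zS1] [S2 S2P zS2]; have [S SP SS] := is_arc_concat S1P S2P.
by exists S => // /SS[].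
Qed.

Lemma avoid_reach_sub i z u v : u \in `[a i, b i] -> v \in `[a i, b i] -> u <= v ->
  (forall w, u <= w -> w <= v -> g i w <> z) -> avoid_reach z (g i u) (g i v).
Proof.
rewrite !in_itv /= => /andP[au ub] /andP[av vb] uv wz.
exists (g i @` `[u, v]); first by exists (g i), u, v; split => //; exact: arc_param_sub (gP i).
by move=> [w /=]; rewrite in_itv /= => /andP[uw wv]; exact: wz.
Qed.

Lemma avoid_reach_sym z x y : avoid_reach z x y -> avoid_reach z y x.
Proof. by move=> [S /is_arc_sym]; exists S. Qed.

Lemma avoid_reach_piece z k x y : piece z k x -> piece z k y -> avoid_reach z x y.
Proof.
move=> [u [uI [uz uv]] <-] [v [vI [vz vv]] <-].
wlog le_uv : u v uI uz uv vI vz vv / u <= v.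
  move=> W; have [|/ltW] := leP u v; first exact: W.
  by move=> vu; apply: avoid_reach_sym; exact: W.
apply: avoid_reach_sub => // w uw wv wz.
have wI : w \in `[a k.1, b k.1].
  move: uI vI; rewrite !in_itv /= => /andP[au _] /andP[_ vb].
  by rewrite (le_trans au) // (le_trans wv).
have := uv w wI wz; have := vv w wI wz.
by case: (k.2) => [+ _|_ +]; rewrite ltNge ?wv ?uw.
Qed.

(** A piece of which one point is reachable from [x] is reachable as a whole.
    Hence both the set of reachable points and its complement are finite unions
    of pieces, and both are relatively closed in [A]. *)
Lemma connected_avoid_reach z x y A : connected A -> ~ A z -> A x -> A y ->
  avoid_reach z x y.
Proof.
move=> coA Az Ax Ay.
have [C_ C_P] := choice (piece_closed z).
have nz w : A w -> w <> z by move=> Aw wz; apply: Az; rewrite -wz.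
pose reached k := exists2 w, piece z k w & avoid_reach z x w.
have reachedE w k : A w -> piece z k w -> avoid_reach z x w <-> reached k.
  move=> Aw kw; split; first by exists w.
  by move=> [v kv xv]; apply: avoid_reach_trans xv _; exact: avoid_reach_piece kv kw.
have fin (P : set ('I_N * bool)) : finite_set P by [].
suff AE : A `&` [set w | avoid_reach z x w] = A by move: Ay; rewrite -AE => -[].
have xx : avoid_reach z x x.
  by have [k kxk] := piece_cover (nz _ Ax); exact: (avoid_reach_piece kxk kxk).
apply: coA; first by exists x.
- exists (~` \bigcup_(k in [set k | ~ reached k]) C_ k).
    apply: closed_openC; apply: closed_bigcup => // k _.
    by have [] := C_P k.
  apply/seteqP; split => w [Aw xw]; split => //=.
    move=> [k nk Ckw]; apply: nk; apply/(reachedE w) => //.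
    by apply/(C_P k).2 => //; exact: nz.
  have [k kw] := piece_cover (nz _ Aw); apply/(reachedE w k) => //.
  apply: contrapT => nk; apply: xw; exists k => //.
  by apply/(C_P k).2 => //; exact: nz.
- exists (\bigcup_(k in reached) C_ k).
    by apply: closed_bigcup => // k _; have [] := C_P k.
  apply/seteqP; split => w [Aw xw]; split => //=.
    have [k kw] := piece_cover (nz _ Aw); exists k; first exact/(reachedE w k).
    by apply/(C_P k).2 => //; exact: nz.
  have [k rk Ckw] := xw; apply/(reachedE w k) => //.
  by apply/(C_P k).2 => //; exact: nz.
Qed.

(** A missing parameter [w] between [u] and [v] would give two arcs from [g i u]
    to [g i v]: the one along [g i], through [g i w], and one avoiding [g i w]. *)
Lemma trace_interval i A : connected A -> is_interval (trace i A).
Proof.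
move=> coA u v [uI Au] [vI Av] w /andP[uw wv].
have wI : w \in `[a i, b i].
  move: uI vI; rewrite !in_itv /= => /andP[au _] /andP[_ vb].
  by rewrite (le_trans au) // (le_trans wv).
split => //; apply: contrapT => Aw.
have uv : g i u <> g i v.
  have [_ _ ig] := gP i; move=> /(ig _ _ uI vI) uv.
  by apply: Aw; have -> : w = u by lra.
have [S SP Sw] := connected_avoid_reach coA Aw Au Av.
apply: Sw; rewrite (uT uv SP (_ : is_arc _ _ (g i @` `[u, v]))).
  by exists w => //=; rewrite in_itv /= uw wv.
exists (g i), u, v; split => //; move: uI vI; rewrite !in_itv /= => /andP[? ?] /andP[? ?].
by apply: arc_param_sub (gP i); rewrite // (le_trans uw).
Qed.

End convexity.

(** * Fine covers, meshes and gates *)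

Section fineness.
Context (R : realType) (T : metricType R).

(** The covering intervals are kept as pairs of endpoints because the endpoints
    themselves supply the points of the mesh in [connected_mesh]. *)
Lemma curve_fine_cover (g : R -> T) (a b e : R) : 0 < e ->
  {within `[a, b], continuous g} ->
  exists s : seq (R * R),
    (forall u, u \in `[a, b] -> exists2 J, J \in s & J.1 < u < J.2) /\
    forall J u v, J \in s -> u \in `[a, b] -> v \in `[a, b] ->
      J.1 < u < J.2 -> J.1 < v < J.2 -> mdist (g u) (g v) <= e.
Proof.
move=> e0 /subspace_continuousP cg.
have r_ex (u : R) : exists r : R, 0 < r /\ (u \in `[a, b] -> forall v,
    v \in `[a, b] -> `|u - v| < r -> mdist (g u) (g v) < e / 2).
  have [uI|nuI] := boolP (u \in `[a, b]); last by exists 1; split.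
  have e2 : 0 < e / 2 by rewrite divr_gt0.
  have /metricType_numDomainType.cvgr_dist_lt/(_ _ e2) := cg u uI.
  rewrite /within /= -nbhs_ballE => -[r /= r0 ru]; exists r; split => // _ v vI uv.
  exact: ru.
have [r rP] := choice r_ex.
have := @segment_compact _ a b; rewrite compact_cover.
move=> /(_ R `[a, b]%classic (fun u => ball u (r u))) [].
- by move=> u _; exact: ball_open.
- by move=> u uI; exists u => //; apply: ballxx; have [] := rP u.
move=> D DI cD.
exists [seq (u - r u, u + r u) | u <- enum_fset D]; split.
  move=> u /cD[v /= vD]; rewrite /ball /= => uv.
  exists (v - r v, v + r v); first by apply/mapP; exists v.
  by move: uv; rewrite ltr_distlC.
move=> _ u v /mapP[w /DI/set_mem wI ->] uI vI uw vw.
have [_ /(_ wI) rw] := rP w.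
have uw' : `|w - u| < r w by rewrite ltr_distlC.
have vw' : `|w - v| < r w by rewrite ltr_distlC.
have := metric_triangle (g u) (g w) (g v).
have := rw _ uI uw'; have := rw _ vI vw'; rewrite (metric_sym (g w) (g u)).
lra.
Qed.

Context (N : nat) (g : 'I_N -> R -> T) (a b : 'I_N -> R).
Local Notation trace := (trace g a b).

Context (uT : unique_arcs T) (cT : arc_cover g a b).

Let gP i : arc_param (g i) (a i) (b i). Proof. exact: cT.1. Qed.

Lemma fine_cover (e : R) : 0 < e -> exists U : seq (set T),
  (forall x, exists2 V, V \in U & V x) /\
  forall V x y, V \in U -> V x -> V y -> mdist x y <= e.
Proof.
move=> e0.
have /choice[s sP] i : exists s, _ :=
  curve_fine_cover e0 (let: And3 _ cg _ := gP i in cg).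
exists [seq g i @` [set u | u \in `[a i, b i] /\ J.1 < u < J.2] |
  i <- enum 'I_N, J <- s i]; split.
  move=> x; have [i [u uI ux]] := cT.2 x.
  have [J Js uI'] := (sP i).1 u uI.
  exists (g i @` [set u | u \in `[a i, b i] /\ J.1 < u < J.2]).
    by apply/allpairsPdep; exists i, J; split => //; rewrite mem_enum.
  by exists u.
move=> _ x y /allpairsPdep[i [J [_ Js ->]]] [u [uI Iu] <-] [v [vI Iv] <-].
exact: (sP i).2 Iu Iv.
Qed.

(** The mesh [P] consists of the endpoints of the intervals of a fine cover of
    each arc. The trace of [A] on an arc is an interval containing none of these
    endpoints, so it stays within one interval of the cover, and each of the [N]
    sets that make up [A] has diameter at most [e / N.+1]. A connected set that
    is the union of [N] sets of such diameter has diameter at most [e]. *)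
Lemma connected_mesh (e : R) : 0 < e -> exists P : seq T,
  forall A, connected A -> (forall p, p \in P -> ~ A p) ->
  forall x y, A x -> A y -> mdist x y <= e.
Proof.
move=> e0; have eN : 0 < e / N.+1%:R by rewrite divr_gt0.
have /choice[s sP] i : exists s, _ :=
  curve_fine_cover eN (let: And3 _ cg _ := gP i in cg).
exists (flatten [seq [seq g i J.1 | J <- s i] ++ [seq g i J.2 | J <- s i] |
  i <- enum 'I_N]).
move=> A coA nA.
have nAi i u : trace i A u -> forall J, J \in s i -> u <> J.1 /\ u <> J.2.
  move=> [uI Au] J Js; split => uE; apply: nA Au; apply/flatten_mapP; exists i;
    rewrite ?mem_enum // mem_cat uE; apply/orP.
    by left; apply/mapP; exists J.
  by right; apply/mapP; exists J.
have small i u v : trace i A u -> trace i A v -> u <= v ->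
    mdist (g i u) (g i v) <= e / N.+1%:R.
  move=> Au Av uv; have itA := trace_interval uT cT (i := i) coA.
  have [J Js /andP[Iu uI]] := (sP i).1 u Au.1.
  apply: ((sP i).2 J) => //; [exact: Au.1|exact: Av.1|by rewrite Iu|].
  rewrite (lt_le_trans Iu uv) /= ltNge; apply/negP => Iv.
  have : trace i A J.2 by apply: (itA u v) => //; rewrite (ltW uI) Iv.
  by move=> /nAi/(_ J Js)[].
move=> x y Ax Ay; rewrite leNgt; apply/negP => xy.
pose D : R := mdist x y.
(* By connectedness the distance to x takes on A each of the N.+1 values
   k * D / N.+1; two of them are taken on the same arc. *)
have itD : is_interval (mdist x @` A).
  apply/connected_intervalP; apply: connected_continuous_connected => //.
  apply: continuous_subspaceT => z; apply/cvgrPdist_lt => d d0.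
  near=> w; have : ball z d w by near: w; exact: nbhsx_ballx.
  rewrite ballEmdist /= => zw.
  rewrite ltr_norml; have := metric_triangle x z w; have := metric_triangle x w z.
  by rewrite (metric_sym w); move: zw => *; apply/andP; split; lra.
have w_ex (k : 'I_N.+1) : exists w, A w /\ mdist x w = k%:R * (D / N.+1%:R).
  have : (mdist x @` A) (k%:R * (D / N.+1%:R)).
    apply: (itD 0 D); [by exists x; rewrite ?mdistxx|by exists y|].
    rewrite mulr_ge0 //=; last by rewrite divr_ge0 // mdist_ge0.
    rewrite mulrCA ler_piMr ?mdist_ge0 // ler_pdivrMr // mul1r ler_nat.
    exact: ltnW.
  by move=> [w Aw wE]; exists w.
have [w wP] := choice w_ex.
have i_ex (k : 'I_N.+1) : exists iu : 'I_N * R, trace iu.1 A iu.2 /\ g iu.1 iu.2 = w k.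
  have [i [u uI uw]] := cT.2 (w k); exists (i, u) => /=; split => //; split => //.
  by rewrite uw; have [] := wP k.
have [iu iuP] := choice i_ex.
have /injectivePn[k [l kl ikl]] : ~~ injectiveb (fun k => (iu k).1).
  apply/negP => /injectiveP/leq_card; rewrite !card_ord; lia.
wlog kl' : k l kl ikl / (k < l)%N.
  move=> W; have [|lk|/val_inj kle] := ltngtP k l; [exact: W| |by rewrite kle eqxx in kl].
  by apply: (W l k) => //; rewrite eq_sym.
have [tk gk] := iuP k; have [tl gl] := iuP l; have [_ dk] := wP k; have [_ dl] := wP l.
have wkl : mdist (w k) (w l) <= e / N.+1%:R.
  rewrite -gk -gl; rewrite -ikl in tl gl *.
  have [|/ltW] := leP (iu k).2 (iu l).2; first exact: small.
  by rewrite metric_sym; exact: small.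
have := metric_triangle x (w k) (w l); rewrite dk dl.
have : e / N.+1%:R < D / N.+1%:R by rewrite ltr_pM2r.
have : k%:R + 1 <= l%:R :> R by rewrite natr1 ler_nat.
set E := D / _; have E0 : 0 <= E by rewrite divr_ge0 // mdist_ge0.
move: wkl; set F := e / _; move=> *; nra.
Unshelve. all: by end_near. Qed.

(** Since [A `|` B] is a subcontinuum when [A] and [B] both contain [p], its
    trace is an interval, and the traces of [A] and [B] cannot be separated by a
    gap: every infimum of a trace lies below every supremum of a trace. The gate
    is the supremum of the infima. *)
Lemma gate_exists (p : T) : exists c : 'I_N -> R, forall A, subcontinuum A ->
  A p -> forall i, trace i A !=set0 -> trace i A (c i).
Proof.
pose Fam i : set (set R) := [set trace i A | A in [set A |
  [/\ subcontinuum A, A p & trace i A !=set0]]].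
exists (fun i => sup [set inf D | D in Fam i]) => A sA Ap i A0.
have closed_sc B : subcontinuum B -> closed (trace i B).
  by move=> [_ cB _]; apply: closed_trace => //; apply: compact_closed cB;
    exact: metric_hausdorff.
have lbt B : has_lbound (trace i B).
  by exists (a i) => u [+ _]; rewrite in_itv /= => /andP[].
have ubt B : has_ubound (trace i B).
  by exists (b i) => u [+ _]; rewrite in_itv /= => /andP[].
have infA := closed_inf_mem (closed_sc _ sA) A0 (lbt A).
have supA := closed_sup_mem (closed_sc _ sA) A0 (ubt A).
have [_ _ coA] := sA.
have inf_le_sup D : Fam i D -> inf D <= sup (trace i A).
  move=> [B [sB Bp B0] <-]; have [_ _ coB] := sB.
  have infB := closed_inf_mem (closed_sc _ sB) B0 (lbt B).
  rewrite leNgt; apply/negP => AB.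
  have AUB : is_interval (trace i (A `|` B)).
    by apply: trace_interval => //; apply: connectedU => //; exists p.
  pose m := (sup (trace i A) + inf (trace i B)) / 2.
  have [mI mAB] : trace i (A `|` B) m.
    apply: (AUB (sup (trace i A)) (inf (trace i B))).
    - by split; [exact: supA.1|left; exact: supA.2].
    - by split; [exact: infB.1|right; exact: infB.2].
    by rewrite /m; apply/andP; split; lra.
  case: mAB => mm.
    by have := ub_le_sup (ubt A) (conj mI mm : trace i A m); rewrite /m; lra.
  by have := ge_inf (lbt B) (conj mI mm : trace i B m); rewrite /m; lra.
have FA : Fam i (trace i A) by exists A.
apply: (trace_interval uT cT coA infA supA); apply/andP; split.
  apply: ub_le_sup; last by exists (trace i A).
  by exists (sup (trace i A)) => _ [D FD <-]; exact: inf_le_sup.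
apply: ge_sup; first by exists (inf (trace i A)), (trace i A).
by move=> _ [D FD <-]; exact: inf_le_sup.
Qed.

End fineness.

(** * Counting with codes, and spanning sets *)

Section counting_and_spanning.
Context (R : realType).
Local Open Scope ereal_scope.

(** The code is a relation rather than a function: the codes used below involve
    arbitrary choices of nearby points. *)
Lemma counting_le_card (X : choiceType) (F : finType) (E : set X)
    (code : X -> F -> Prop) :
  (forall x, exists c, code x c) ->
  (forall x y c, E x -> E y -> code x c -> code y c -> x = y) ->
  counting E <= (#|F|%:R : R)%:E.
Proof.
move=> /choice[k kP] cE.
have EI : (E #<= `I_#|F|)%card.
  have kinj : set_inj E (fun x => enum_rank (k x) : nat).
    move=> x y /set_mem Ex /set_mem Ey /val_inj/enum_rank_inj kxy.
    by apply: cE Ex Ey (kP x) _; rewrite kxy; exact: kP.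
  have /card_eqPle[_ EkE] := inj_card_eq kinj.
  apply: card_le_trans EkE _; apply: subset_card_le => _ [x _ <-] /=.
  exact: ltn_ord.
rewrite /counting asboolT; first by rewrite lee_fin ler_nat geq_card_fset_set.
exact: card_le_finite EI _.
Qed.

Context (X : metricType R) (g : X -> X).

Lemma bowen_dist_le n x y (e : R) : (0 <= e)%R ->
  (forall j, (j < n)%N -> mdist (iter j g x) (iter j g y) <= e)%R ->
  (bowen_dist g n x y <= e)%R.
Proof. by move=> e0 xy; apply: bigmax_le => // j _; exact: xy. Qed.

Lemma le_bowen_dist n x y j : (j < n)%N ->
  (mdist (iter j g x) (iter j g y) <= bowen_dist g n x y)%R.
Proof.
move=> jn; rewrite /bowen_dist.
exact: (le_bigmax _ (fun j : 'I_n => mdist (iter j g x) (iter j g y)) (Ordinal jn)).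
Qed.

Lemma bowen_distC n x y : bowen_dist g n x y = bowen_dist g n y x.
Proof. by apply: eq_bigr => j _; rewrite metric_sym. Qed.

(** A separated set of maximal cardinality is spanning. *)
Lemma spanning_seq n (e : R) : (0 <= e)%R -> sep g n e < +oo ->
  exists s : seq X, ((size s)%:R : R)%:E <= sep g n e /\
    forall x, exists i : 'I_(size s), (bowen_dist g n (tnth (in_tuple s) i) x <= e)%R.
Proof.
move=> e0 sepoo.
have card_sep (A : {fset X}) : separated_set g n e [set` A] ->
    (#|` A|%:R : R)%:E <= sep g n e.
  move=> sA; apply: ereal_sup_ubound; exists [set` A] => //.
  by rewrite /counting asboolT ?set_fsetK //; exact: finite_fset.
have sep_fin : sep g n e \is a fin_num.
  by rewrite ge0_fin_numE //; apply: le_trans (card_sep fset0 _) => // x y.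
pose P k := `[< exists2 A : {fset X}, separated_set g n e [set` A] & #|` A| = k >].
have P0 : exists k, P k by exists 0%N; apply/asboolP; exists fset0 => // x y.
have Pub k : P k -> (k <= Num.trunc (fine (sep g n e)))%N.
  move=> /asboolP[A /card_sep sA <-]; rewrite -ltnS -(ltr_nat R).
  apply: le_lt_trans (truncnS_gt _); first by rewrite -lee_fin fineK.
have [k /asboolP[A sA Ak] kmax] := ex_maxnP P0 Pub.
exists (enum_fset A); split; first exact: card_sep.
move=> x; apply: contrapT => nx.
have far y : y \in A -> (e < bowen_dist g n y x)%R.
  move=> yA; rewrite ltNge; apply/negP => yx; apply: nx.
  have iA : (index y (enum_fset A) < size (enum_fset A))%N by rewrite index_mem.
  by exists (Ordinal iA); rewrite (tnth_nth y) /= nth_index.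
have xA : x \notin A.
  apply/negP => /far; rewrite ltNge => /negP; apply.
  by apply: bowen_dist_le => // j _; rewrite mdistxx.
have : P k.+1.
  apply/asboolP; exists (x |` A)%fset; last by rewrite cardfsU1 xA Ak.
  move=> y z /=; rewrite !in_fset1U => /predU1P[->|yA] /predU1P[->|zA] // yz.
  - by rewrite bowen_distC far.
  - exact: far.
  - exact: sA.
by move=> /kmax; rewrite ltnn.
Qed.

End counting_and_spanning.

(** * Complexity of nested families *)

Section hits.
Context (T : Type) (f : T -> T) (n : nat) (U : seq (set T)).

Definition hits (C : set T) : {set 'I_n * 'I_(size U)} :=
  [set jk : 'I_n * 'I_(size U) |
    `[< exists2 x, C x & nth set0 U jk.2 (iter jk.1 f x) >]]%SET.

Lemma hits_sub C D : C `<=` D -> hits C \subset hits D.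
Proof.
move=> CD; apply/fintype.subsetP => jk; rewrite !inE => /asboolP[x Cx jkx].
by apply/asboolP; exists x => //; exact: CD.
Qed.

(** This is where nested families become cheap: on a chain, the set [hits C], of
    which there could be exponentially many, is determined by a number. *)
Lemma hits_nested C D : C `<=` D \/ D `<=` C -> #|hits C| = #|hits D| ->
  hits C = hits D.
Proof.
move=> [|] /hits_sub CD E; apply/eqP; first by rewrite eqEcard CD E /=.
by rewrite eq_sym eqEcard CD E /=.
Qed.

Lemma hits_bigcup (J : Type) (C D : J -> set T) :
  (forall j, hits (C j) = hits (D j)) -> hits (\bigcup_j C j) = hits (\bigcup_j D j).
Proof.
move=> CD; apply/setP => jk; rewrite !inE; apply/asboolP/asboolP.
  move=> [x [j _ Cx] jkx].
  have : jk \in hits (C j) by rewrite inE; apply/asboolP; exists x.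
  by rewrite CD inE => /asboolP[y Dy jky]; exists y => //; exists j.
move=> [x [j _ Cx] jkx].
have : jk \in hits (D j) by rewrite inE; apply/asboolP; exists x.
by rewrite -CD inE => /asboolP[y Dy jky]; exists y => //; exists j.
Qed.

End hits.

(** * Separated sets of the connected envelope *)

Section envelope_upper_bound.
Context (R : realType) (T : metricType R) (f : T -> T) (hf : continuous f).
Context (N : nat) (g : 'I_N -> R -> T) (a b : 'I_N -> R).
Local Notation trace := (trace g a b).
Context (uT : unique_arcs T) (cT : arc_cover g a b).
Implicit Types (A B C : Con T).

Lemma iter_envelope j A : val (iter j (envelope_map hf) A) = iter j f @` val A.
Proof.
elim: j => [|j IH]; first by rewrite /= image_id.
by rewrite !iterS /= IH image_comp.
Qed.

Lemma hausdorff_dist_near (S1 S2 : set T) (e : R) : S1 !=set0 -> S2 !=set0 ->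
  (forall x, S1 x -> exists2 y, S2 y & mdist x y <= e) ->
  (forall x, S2 x -> exists2 y, S1 y & mdist x y <= e) ->
  hausdorff_dist S1 S2 <= e.
Proof.
move=> S10 S20 S12 S21; apply: hausdorff_dist_le => // x.
  by move=> /S12[y Sy xy]; exact: le_trans (dist_to_set_le x Sy) xy.
by move=> /S21[y Sy xy]; exact: le_trans (dist_to_set_le x Sy) xy.
Qed.

Lemma hausdorff_dist_hits n (U : seq (set T)) (e : R) (S1 S2 : set T) j :
  (forall x, exists2 V, V \in U & V x) ->
  (forall V x y, V \in U -> V x -> V y -> mdist x y <= e) ->
  (j < n)%N -> S1 !=set0 -> S2 !=set0 -> hits f n U S1 = hits f n U S2 ->
  hausdorff_dist (iter j f @` S1) (iter j f @` S2) <= e.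
Proof.
move=> cU sU jn.
have near S S' : hits f n U S = hits f n U S' -> forall x, (iter j f @` S) x ->
    exists2 y, (iter j f @` S') y & mdist x y <= e.
  move=> SS' _ [x Sx <-]; have [V VU Vx] := cU (iter j f x).
  have kU : (index V U < size U)%N by rewrite index_mem.
  have : (Ordinal jn, Ordinal kU) \in hits f n U S.
    by rewrite inE; apply/asboolP; exists x => //=; rewrite nth_index.
  rewrite SS' inE => /asboolP[y Sy /=]; rewrite nth_index // => Vy.
  by exists (iter j f y); [exists y|exact: sU VU _ _].
move=> [x1 S1x] [x2 S2x] S12; apply: hausdorff_dist_near.
- by exists (iter j f x1), x1.
- by exists (iter j f x2), x2.
- exact: near.
- by apply: near; rewrite S12.
Qed.

Definition half (c : 'I_N -> R) (S : set T) (k : 'I_N * bool) : set T :=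
  g k.1 @` [set u | trace k.1 S u /\ if k.2 then u <= c k.1 else c k.1 <= u].

Lemma half_cover c S : S = \bigcup_k half c S k.
Proof.
apply/seteqP; split => x.
  have [i [u uI ux]] := cT.2 x => Sx.
  have tu : trace i S u by split; rewrite ?ux.
  have [uc|/ltW cu] := leP u (c i).
    by exists (i, true) => //; exists u.
  by exists (i, false) => //; exists u.
by move=> [k _ [u [[_ Su] _] <-]].
Qed.

(** On a given side of a parameter common to both, two intervals are nested. *)
Lemma half_nested c A B k :
  (forall i, trace i (val A) !=set0 -> trace i (val A) (c i)) ->
  (forall i, trace i (val B) !=set0 -> trace i (val B) (c i)) ->
  half c (val A) k `<=` half c (val B) k \/ half c (val B) k `<=` half c (val A) k.
Proof.
move=> Ac Bc.
have [[_ _ coA] [_ _ coB]] := (ConP A, ConP B).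
have itA := trace_interval uT cT (i := k.1) coA.
have itB := trace_interval uT cT (i := k.1) coB.
have [AB|nAB] := pselect (half c (val A) k `<=` half c (val B) k); first by left.
right; move/existsNP: nAB => [x /not_implyP[[u [Au uc] <-] nB]].
move=> _ [v [Bv vc] <-]; exists v => //; split => //.
have tA := Ac k.1 (ex_intro _ u Au); have tB := Bc k.1 (ex_intro _ v Bv).
have nBu : ~ trace k.1 (val B) u by move=> Bu; apply: nB; exists u.
case: (k.2) uc vc => uc vc.
  apply: (itA u (c k.1)) => //; rewrite vc andbT leNgt; apply/negP => /ltW vu.
  by apply: nBu; apply: (itB v (c k.1)) => //; rewrite vu.
apply: (itA (c k.1) u) => //; rewrite vc /= leNgt; apply/negP => /ltW vu.
by apply: nBu; apply: (itB (c k.1) v) => //; rewrite uc.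
Qed.

(** The factor counts the codes: for continua whose images meet the mesh, a
    first meeting time ([n] values), a point of the mesh met at that time ([m]
    values) and the cardinality of [hits] for each of the [2 * N] halves (at most
    [(n * K).+1] values); one more code for the continua that always miss the
    mesh. The radius [e / 4] leaves room for two points close to the same element
    of the spanning set, plus the diameter [e / 2] of a continuum missing the
    mesh. *)
Lemma sep_envelope_le (e : R) : 0 < e -> exists m K : nat, forall n,
  (sep (envelope_map hf) n e <=
   ((n * m * (n * K).+1 ^ (2 * N)).+1%:R : R)%:E * sep f n (e / 4))%E.
Proof.
move=> e0; have e2 : 0 < e / 2 by rewrite divr_gt0.
have [P meshP] := connected_mesh uT cT e2.
have [U [cU sU]] := fine_cover cT e0.
have [c cP] := choice (gate_exists uT cT).
exists (size P), (size U) => n.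
have [->|sepn] := eqVneq (sep f n (e / 4)) +oo%E.
  by rewrite gt0_muley ?leey // lte_fin.
have e4 : 0 <= e / 4 by rewrite divr_ge0 // ltW.
have [|s [szs spans]] := @spanning_seq R T f n (e / 4) e4.
  by rewrite ltey.
(* None encodes the continua whose first n images all miss the mesh. *)
pose F : finType := ('I_(size s) * option ('I_n * 'I_(size P) *
  {ffun 'I_N * bool -> 'I_(n * size U).+1}))%type.
apply: (@le_trans _ _ (#|F|%:R : R)%:E); last first.
  rewrite card_prod card_option !card_prod card_ffun !card_ord card_prod card_bool.
  rewrite card_ord (mulnC N) mulnC natrM EFinM lee_wpmul2l // lee_fin //.
pose pt (i : 'I_(size P)) := tnth (in_tuple P) i.
pose early t A := forall j, (j < t)%N -> forall p, p \in P -> ~ (iter j f @` val A) p.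
pose code A (d : F) :=
  (exists2 x, val A x & bowen_dist f n (tnth (in_tuple s) d.1) x <= e / 4) /\
  match d.2 with
  | None => early n A
  | Some (t, i, h) => [/\ early t A, (iter t f @` val A) (pt i) &
      forall k, h k = #|hits f n U (half (c (pt i)) (iter t f @` val A) k)| :> nat]
  end.
apply: ge_ereal_sup => _ [E sE <-]; apply: (@counting_le_card R _ _ E code).
  move=> A; have [[x Ax] _ _] := ConP A; have [i xi] := spans x.
  have [[j hj]|nohit] := pselect (exists j, (j < n)%N /\
      exists2 p, p \in P & (iter j f @` val A) p); last first.
    exists (i, None); split; first by exists x.
    by move=> j jn p pP Ap; apply: nohit; exists j; split => //; exists p.
  pose hit j := `[< (j < n)%N /\ exists2 p, p \in P & (iter j f @` val A) p >].
  have exhit : exists j, hit j by exists j; apply/asboolP.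
  have [t /asboolP[tn [p pP Ap]] tmin] := ex_minnP exhit.
  have ip : (index p P < size P)%N by rewrite index_mem.
  have hb k : (#|hits f n U (half (c p) (iter t f @` val A) k)| < (n * size U).+1)%N.
    by rewrite ltnS (leq_trans (max_card _)) // card_prod !card_ord.
  exists (i, Some (Ordinal tn, Ordinal ip, [ffun k => Ordinal (hb k)])).
  split; first by exists x.
  have ptp : pt (Ordinal ip) = p by rewrite /pt (tnth_nth p) /= nth_index.
  split; [|by rewrite ptp|by move=> k; rewrite ffunE ptp].
  move=> j' /= j't q qP Aq; suff : (t <= j')%N by rewrite leqNgt j't.
  by apply: tmin; apply/asboolP; split; [exact: ltn_trans j't tn|exists q].
move=> A B d EA EB [[x Ax dx] dA] [[y By dy] dB]; apply: contrapT => AB.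
have := sE _ _ EA EB AB; rewrite ltNge => /negP; apply.
apply: bowen_dist_le; first exact: ltW.
move=> j jn; rewrite /mdist /= /Con_dist !iter_envelope.
have iter0 S k : S !=set0 -> (iter k f @` S) !=set0.
  by move=> [z Sz]; exists (iter k f z), z.
have nonempty k C : (iter k f @` val C) !=set0.
  by apply: iter0; have [] := ConP C.
have xy : mdist (iter j f x) (iter j f y) <= e / 2.
  have := le_bowen_dist f (tnth (in_tuple s) d.1) x jn.
  have := le_bowen_dist f (tnth (in_tuple s) d.1) y jn.
  have := metric_triangle (iter j f x) (iter j f (tnth (in_tuple s) d.1)) (iter j f y).
  by rewrite (metric_sym (iter j f x) (iter j f (tnth _ _))); move=> *; lra.
have small t C : early t C -> (j < t)%N -> forall z w,
    val C z -> val C w -> mdist (iter j f z) (iter j f w) <= e / 2.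
  move=> eC jt z w Cz Cw.
  apply: (meshP (iter j f @` val C)); [|exact: eC|by exists z|by exists w].
  by rewrite -iter_envelope; have [] := ConP (iter j (envelope_map hf) C).
have close t : early t A -> early t B -> (j < t)%N ->
    hausdorff_dist (iter j f @` val A) (iter j f @` val B) <= e.
  move=> eA eB jt; apply: hausdorff_dist_near => //.
    move=> _ [z Az <-]; exists (iter j f y); first by exists y.
    have := small _ _ eA jt z x Az Ax.
    by have := metric_triangle (iter j f z) (iter j f x) (iter j f y); lra.
  move=> _ [z Bz <-]; exists (iter j f x); first by exists x.
  have := small _ _ eB jt z y Bz By.
  have := metric_triangle (iter j f z) (iter j f y) (iter j f x).
  by rewrite (metric_sym (iter j f y)); lra.
case: d {dx dy} dA dB xy => i [[[t ip] h]|] /=; last by move=> eA eB _; exact: close jn.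
move=> [eA Ap hA] [eB Bp hB] _; have [jt|tj] := ltnP j t; first exact: close jt.
rewrite -(subnK tj).
have split_iter C : iter (j - t + t) f @` val C = iter (j - t) f @` (iter t f @` val C).
  by rewrite image_comp; congr (_ @` _); apply/funext => z; rewrite iterD.
rewrite !split_iter; apply: (@hausdorff_dist_hits n _ _ _ _ _ cU sU) => //.
  exact: leq_ltn_trans (leq_subr _ _) jn.
have gate C : (iter t f @` val C) (pt ip) -> forall i, trace i (iter t f @` val C) !=set0 ->
    trace i (iter t f @` val C) (c (pt ip) i).
  move=> Cp; apply: cP => //; rewrite -iter_envelope; exact: ConP.
rewrite (half_cover (c (pt ip)) (iter t f @` val A)).
rewrite (half_cover (c (pt ip)) (iter t f @` val B)).
apply: hits_bigcup => k; apply: hits_nested; last by rewrite -hA -hB.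
by rewrite -!iter_envelope; apply: half_nested; rewrite iter_envelope; exact: gate.
Qed.

End envelope_upper_bound.

(** * Entropy as a limit *)

Section limits.
Context (R : realType).
Local Open Scope ereal_scope.

Lemma limn_esup_le_shift (u v : nat -> \bar R) :
  (forall e : R, (0 < e)%R -> \forall n \near \oo, u n <= e%:E + v n) ->
  limn_esup u <= limn_esup v.
Proof.
move=> uv; rewrite [leRHS]limf_esupE; apply: le_ereal_inf_tmp => _ [V Voo <-].
apply/lee_addgt0Pr => e e0; rewrite /limn_esup limf_esupE.
apply: le_trans (ereal_inf_lbound _) _.
  exists (V `&` [set n | u n <= e%:E + v n]); last reflexivity.
  by apply: filterI => //; exact: uv.
apply: ge_ereal_sup => _ [n [Vn /= uvn] <-]; apply: le_trans uvn _.
by rewrite addeC leeD2r //; apply: ereal_sup_ubound; exists n.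
Qed.

(** The left-hand side is at most [(Q * n) ^ M] with [M = L.+2], while the
    exponential dominates its Taylor term of degree [M.+1]. *)
Lemma polynomial_le_exp (m K L : nat) (e : R) : (0 < e)%R ->
  \forall n \near \oo, ((n * m * (n * K).+1 ^ L).+1%:R <= expR (e * n%:R))%R.
Proof.
move=> e0; pose M := L.+2; pose Q := ((m.+1 * K.+1).+1 * 2)%N.
have eM : (0 < e ^+ M.+1)%R by rewrite exprn_gt0.
near=> n.
have n1 : (1 <= n)%N by near: n; exact: nbhs_infty_ge.
have nbig : ((Q ^ M)%:R * M.+1`!%:R / e ^+ M.+1 <= n%:R :> R)%R.
  by near: n; exact: nbhs_infty_ger.
have poly : ((n * m * (n * K).+1 ^ L).+1 <= (Q * n) ^ M)%N.
  have nm : (n * m <= Q * n)%N by rewrite /Q; nia.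
  have nK : ((n * K).+1 <= Q * n)%N by rewrite /Q; nia.
  have Q1 : (2 <= Q * n)%N by rewrite /Q; nia.
  have pw : (n * m * (n * K).+1 ^ L <= (Q * n) ^ L.+1)%N.
    by rewrite expnS leq_mul //; case: (L) => // l; rewrite leq_exp2r.
  have p1 : (1 <= (Q * n) ^ L.+1)%N by rewrite expn_gt0; lia.
  rewrite /M expnS; move: pw p1; set p := (_ ^ L.+1)%N; nia.
apply: (@le_trans _ _ (((Q * n) ^ M)%:R)); first by rewrite ler_nat.
have en0 : (0 <= e * n%:R)%R by rewrite mulr_ge0 // ltW.
apply: le_trans (expR_ge1Dxn M en0).
apply: (@le_trans _ _ ((e * n%:R) ^+ M.+1 / M.+1`!%:R)%R); last by rewrite lerDr.
rewrite ler_pdivlMr ?ltr0n ?fact_gt0 // exprMn (exprS n%:R) mulrA.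
rewrite expnMn natrM (natrX _ n M) [leLHS]mulrAC ler_wpM2r ?exprn_ge0 //.
by move: nbig; rewrite ler_pdivrMr // (mulrC n%:R).
Unshelve. all: by end_near. Qed.

Context (X : metricType R) (g : X -> X).

Lemma topological_entropyE :
  topological_entropy g = ereal_sup [set entropy_at g e | e in `]0%R, +oo[%classic].
Proof.
apply: cvg_lim => //; apply: nonincreasing_at_right_cvge => // x y _ _.
exact: entropy_at_nonincreasing.
Qed.

Lemma entropy_at_le_topological (e : R) : (0 < e)%R ->
  entropy_at g e <= topological_entropy g.
Proof.
move=> e0; rewrite topological_entropyE; apply: ereal_sup_ubound.
by exists e => //=; rewrite in_itv /= e0.
Qed.

Lemma topological_entropy_le (M : \bar R) :
  (forall e : R, (0 < e)%R -> entropy_at g e <= M) -> topological_entropy g <= M.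
Proof.
move=> gM; rewrite topological_entropyE; apply: ge_ereal_sup => _ [e + <-].
by rewrite /= in_itv /= andbT; exact: gM.
Qed.

Lemma sep_ge1 n (e : R) (x : X) : 1 <= sep g n e.
Proof.
apply: ereal_sup_ubound; exists [set x]; first by move=> y z -> ->.
by rewrite /counting asboolT // fset_set1 cardfs1.
Qed.

End limits.

(** A factor [c] of subexponential growth disappears in the limit. *)
Lemma entropy_at_le_subexp (R : realType) (X Y : metricType R) (g : X -> X)
    (h : Y -> Y) (x : X) (y : Y) (d e : R) (c : nat -> R) :
  (forall n, (sep g n d <= (c n)%:E * sep h n e)%E) ->
  (forall t : R, 0 < t -> \forall n \near \oo, c n <= expR (t * n%:R)) ->
  (entropy_at g d <= entropy_at h e)%E.
Proof.
move=> gh cexp; apply: limn_esup_le_shift => t t0; near=> n.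
have n0 : 0 < n%:R :> R by rewrite ltr0n; near: n; exact: nbhs_infty_gt.
have cn : c n <= expR (t * n%:R) by near: n; exact: cexp.
have g1 := sep_ge1 g n d x; have h1 := sep_ge1 h n e y.
have h0 : (0 < sep h n e)%E by exact: lt_le_trans h1.
have E0 : (0 < (expR (t * n%:R))%:E)%E by rewrite lte_fin expR_gt0.
have gexp : (sep g n d <= (expR (t * n%:R))%:E * sep h n e)%E.
  by apply: le_trans (gh n) _; rewrite lee_wpmul2r ?lee_fin // ltW.
apply: (@le_trans _ _ ((n%:R)^-1%:E * lne ((expR (t * n%:R))%:E * sep h n e))%E).
  rewrite lee_wpmul2l ?lee_fin ?invr_ge0 ?(ltW n0) //.
  by rewrite lee_lne // in_itv /= leey andbT ?mule_ge0 ?ltW // (lt_le_trans _ g1).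
rewrite lneM; first last.
- by rewrite in_itv /= h0 leey.
- by rewrite in_itv /= E0 leey.
rewrite lne_EFin ?expR_gt0 // expRK.
rewrite muleDr ?fin_num_adde_defr //.
by rewrite leeD2r // -EFinM lee_fin mulrC mulfK // gt_eqF.
Unshelve. all: by end_near. Qed.

(** * Singletons in the connected envelope *)

Section singletons.
Context (R : realType) (T : metricType R) (f : T -> T) (hf : continuous f).

Lemma subcontinuum1 (x : T) : subcontinuum [set x].
Proof. by split; [exists x|exact: compact_set1|exact: connected1]. Qed.

Definition singleton_continuum (x : T) : Con T :=
  SigSub (mem_set (subcontinuum1 x)).

Lemma singleton_continuum_dist (x y : T) :
  mdist (singleton_continuum x) (singleton_continuum y) = mdist x y.
Proof.
have d1 (u v : T) : dist_to_set u [set v] = mdist u v.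
  by rewrite /dist_to_set image_set1 inf1.
rewrite /mdist /= /Con_dist /hausdorff_dist /= !image_set1 !sup1 !d1.
by rewrite (metric_sym y) maxxx.
Qed.

Lemma iter_envelope_singleton j (x : T) :
  iter j (envelope_map hf) (singleton_continuum x) = singleton_continuum (iter j f x).
Proof. by elim: j => //= j ->; apply: val_inj; rewrite /= image_set1. Qed.

Lemma singleton_continuum_inj : injective singleton_continuum.
Proof.
move=> x y xy; apply: mdist_positivity.
by rewrite -singleton_continuum_dist xy mdistxx.
Qed.

Lemma sep_le_envelope n (e : R) : (sep f n e <= sep (envelope_map hf) n e)%E.
Proof.
apply: ge_ereal_sup => _ [E sE <-]; apply: ereal_sup_ubound.
exists (singleton_continuum @` E).
  move=> _ _ [x Ex <-] [y Ey <-] xy.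
  have -> : bowen_dist (envelope_map hf) n (singleton_continuum x)
      (singleton_continuum y) = bowen_dist f n x y.
    by apply: eq_bigr => j _; rewrite !iter_envelope_singleton singleton_continuum_dist.
  by apply: sE => // xyE; apply: xy; rewrite xyE.
have cE : (singleton_continuum @` E #= E)%card.
  by apply: inj_card_eq => x y _ _; exact: singleton_continuum_inj.
rewrite /counting; have [fE|iE] := pselect (finite_set E).
  have fE' : finite_set (singleton_continuum @` E) by exact: finite_image.
  by rewrite !asboolT //; congr (_%:R%:E); apply/fcard_eq.
rewrite !asboolF // => fE'; apply: iE; move: fE'.
by rewrite (eq_finite_set cE).
Qed.

End singletons.

(** * The entropy of the connected envelope *)

Lemma tree_unique_arcs (R : realType) (T : metricType R) :
  tree R T -> unique_arcs T.
Proof.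
move=> [uT _] x y S1 S2 xy S1P S2P; have [A [_ AU]] := uT x y xy.
by rewrite -(AU S1) ?(AU S2) //; exact: is_arc_arc_between.
Qed.

Lemma tree_arc_cover (R : realType) (T : metricType R) : tree R T ->
  inhabited T /\ exists N (g : 'I_N -> R -> T) a b, arc_cover g a b.
Proof.
move=> [_ [[x xT]|[n [A [Ai AT]]]]].
  split; first by constructor.
  exists 1%N, (fun _ _ => x), (fun=> 0), (fun=> 0); split.
    move=> _; split => //; first by apply: continuous_subspaceT => u; exact: cvg_cst.
    by move=> u v; rewrite !in_itv /= -!eq_le => /eqP <- /eqP <-.
  move=> y; exists ord0, 0; first by rewrite /= in_itv /= lexx.
  by have : [set: T] y by []; rewrite xT.
have /choice[g gP] i := topological_interval_param (Ai i).
have /choice[a aP] := gP; have /choice[b bP] := aP.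
split; first by constructor; exact: (g ord0 (a ord0)).
exists n.+1, g, a, b; split; first by move=> i; have [] := bP i.
move=> x; have : [set: T] x by [].
by rewrite AT => -[i _]; have [_ ->] := bP i; exists i.
Qed.

Theorem theorem4 (R : realType) (T : metricType R) (hT : tree R T)
    (f : T -> T) (hf : continuous f) :
  topological_entropy (envelope_map hf) = topological_entropy f.
Proof.
have uT := tree_unique_arcs hT.
have [[x] [N [g [a [b cT]]]]] := tree_arc_cover hT.
apply/eqP; rewrite eq_le; apply/andP; split.
  apply: topological_entropy_le => e e0.
  have e4 : 0 < e / 4 by rewrite divr_gt0.
  apply: le_trans (entropy_at_le_topological f e4).
  have [m [K sepK]] := sep_envelope_le hf uT cT e0.
  apply: entropy_at_le_subexp sepK _ => //; first exact: singleton_continuum x.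
  by move=> t t0; exact: polynomial_le_exp.
apply: topological_entropy_le => e e0.
apply: le_trans (entropy_at_le_topological (envelope_map hf) e0).
apply: (entropy_at_le_subexp x (singleton_continuum x) (c := fun=> 1)).
  by move=> n; rewrite mul1e; exact: sep_le_envelope.
by move=> t t0; apply: nearW => n; rewrite -expR0 ler_expR mulr_ge0 // ltW.
Qed.
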